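(* Let $d\ge 2$ and $n\ge 1$ be integers. Then $$p^{(d)}(n)=\sum_{i\ge 1}\hat{p}^{(1)}_i\!\left(n-(d-2)\binom{i}{2}\right),$$ where $p^{(d)}(n)$ is the number of partitions of $n$ with $d$-distant parts and, for an integer $m$ and $i\ge1$, $\hat{p}^{(1)}_i(m)$ is the number of partitions of $m$ into exactly $i$ distinct parts whose smallest even part is greater than twice the number of odd parts (with $\hat{p}^{(1)}_i(m)=0$ for $m\le 0$). Only the terms with $1\le i\le l(n,d)$ can be nonzero, where $l(n,d)$ is the maximal length of a partition of $n$ with $d$-distant parts.
   Context: A partition of $n$ is a non-increasing sequence of positive integers $\lambda_1\ge\cdots\ge\lambda_l$ summing to $n$; it has $d$-distant parts if $\lambda_j-\lambda_{j+1}\ge d$ for all $j<l$ (so $1$-distant means all parts are distinct). For a partition $\mu$ with distinct parts, $l_o(\mu)$ denotes its number of odd parts and $e(\mu)$ its smallest even part; the condition ''smallest even part greater than twice the number of odd parts'' means $e(\mu)>2l_o(\mu)$, and it is regarded as satisfied when $\mu$ has no even parts. *)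

(* Defs.v *)
From mathcomp Require Export all_boot all_order all_algebra.
From mathcomp Require Export classical_sets fsbigop.

Set Implicit Arguments.
Unset Strict Implicit.
Unset Printing Implicit Defensive.

Definition is_partition (n : nat) (s : seq nat) : bool :=
  [&& sorted geq s, all (fun x => 0 < x) s & sumn s == n].

Definition distant (d : nat) (s : seq nat) : bool :=
  sorted (fun x y => y + d <= x) s.

Definition odd_parts (s : seq nat) : nat := count odd s.

Definition smallest_even (s : seq nat) : option nat :=
  if [seq x <- s | ~~ odd x] is x :: r then Some (foldr minn x r) else None.

Definition even_condition (s : seq nat) : bool :=
  if smallest_even s is Some e then 2 * odd_parts s < e else true.

(* A partition of n has at most n parts, each at most n, so all partitions of n
   are found among the sequences of length at most n over {0, ..., n}; see
   is_partition_box. *)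
Definition box (n : nat) : finType := {bseq n of 'I_n.+1}.

Definition box_seq (n : nat) (b : box n) : seq nat := [seq val x | x <- b].

Definition count_partitions (n : nat) (P : pred (seq nat)) : nat :=
  #|[pred b : box n | is_partition n (box_seq b) && P (box_seq b)]|.

Definition p_distant (d n : nat) : nat := count_partitions n (distant d).

Definition phat_prop (i : nat) (s : seq nat) : bool :=
  [&& size s == i, distant 1 s & even_condition s].

Definition phat (i : nat) (m : int) : nat :=
  if (0 < m)%R then count_partitions `|m|%N (phat_prop i) else 0.

Definition max_length (n d : nat) : nat :=
  \max_(b : box n | is_partition n (box_seq b) && distant d (box_seq b))
     size (box_seq b).

Lemma box_seq_inj n : injective (@box_seq n).
Proof. by move=> b c /(inj_map val_inj) /val_inj. Qed.

Lemma is_partition_box n s :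
  is_partition n s -> exists b : box n, box_seq b = s.
Proof.
case/and3P=> _ pos /eqP sumE.
have size_le : size s <= n.
  rewrite -sumE; elim: s pos {sumE} => //= x s IH /andP[x_gt0 /IH].
  by move=> le_s; rewrite -add1n leq_add.
have lt_n x : x \in s -> x < n.+1.
  rewrite ltnS -sumE; elim: s {pos size_le sumE} => //= y s IH.
  rewrite inE => /orP[/eqP-> | /IH le_x]; first exact: leq_addr.
  exact: leq_trans le_x (leq_addl _ _).
have size_le' : size [seq inord x : 'I_n.+1 | x <- s] <= n by rewrite size_map.
exists (Bseq size_le'); rewrite /box_seq /= -map_comp.
by rewrite -[RHS]map_id; apply/eq_in_map => x /lt_n /= /inordK.
Qed.

(* Main.v *)
Require Import Defs.
From mathcomp Require Import zify.

(* Fix the number i of parts. Subtracting the staircase 1, 1 + d, 1 + 2d, ...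
   from a partition of n with i d-distant parts leaves a non-increasing
   sequence v of i natural numbers, with n = |v| + i + d 'C(i, 2). Now list the
   odd entries of v before the even ones, say k even ones, and add the staircase
   1, 3, 5, ... from the right: the even entries become k distinct odd parts,
   and the odd entries become distinct even parts that exceed 2k. Sorting gives
   exactly the partitions counted by phat i, with sum
   |v| + i + 2 'C(i, 2) = n - (d - 2) 'C(i, 2), and parities allow to undo
   every step. *)

(** * Adding and removing staircases *)

(* The offset [k] is the number of entries to the right of [s] when [s] is a
   prefix of the sequence to which the staircase is added. *)
Fixpoint add_stair (d k : nat) (s : seq nat) : seq nat :=
  if s is x :: r then x + d * (k + size r) + 1 :: add_stair d k r else [::].

Fixpoint sub_stair (d k : nat) (s : seq nat) : seq nat :=
  if s is x :: r then x - (d * (k + size r) + 1) :: sub_stair d k r else [::].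

Lemma size_add_stair d k s : size (add_stair d k s) = size s.
Proof. by elim: s => //= x s ->. Qed.

Lemma size_sub_stair d k s : size (sub_stair d k s) = size s.
Proof. by elim: s => //= x s ->. Qed.

Lemma add_stairK d k : cancel (add_stair d k) (sub_stair d k).
Proof. by elim=> //= x s ->; rewrite size_add_stair -addnA addnK. Qed.

Lemma add_stair_cat d k s t :
  add_stair d k (s ++ t) = add_stair d (k + size t) s ++ add_stair d k t.
Proof. by elim: s => //= x s ->; rewrite size_cat; congr (_ + _ * _ + _ :: _); lia. Qed.

Lemma sub_stair_cat d k s t :
  sub_stair d k (s ++ t) = sub_stair d (k + size t) s ++ sub_stair d k t.
Proof. by elim: s => //= x s ->; rewrite size_cat; congr (_ - (_ * _ + _) :: _); lia. Qed.

Lemma sumn_add_stair d s :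
  sumn (add_stair d 0 s) = sumn s + size s + d * 'C(size s, 2).
Proof. by elim: s => [|x s] /=; rewrite ?muln0 // => ->; rewrite binS bin1; nia. Qed.

Lemma add_stair_gt d k s : all (fun x => d * k < x) (add_stair d k s).
Proof. by elim: s => //= x s ->; rewrite andbT; nia. Qed.

Lemma distant_add_stair d k s : sorted geq s -> distant d (add_stair d k s).
Proof.
by elim: s => //= x [|y s] //= IH /andP[xy /IH ->]; rewrite andbT; nia.
Qed.

(** Truncated subtraction is monotone, and the gap of [d] between neighbours pays for the extra [d]
    taken from the left one. *)
Lemma sorted_sub_stair d k s : distant d s -> sorted geq (sub_stair d k s).
Proof.
rewrite /distant; elim: s => //= x [|y s] //= IH /andP[xy /IH ->].
by rewrite andbT; nia.
Qed.

(** The last entry exceeds [d * k], and each of the [size s] steps to the left gains at least [d].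
    This keeps the subtraction in [sub_stair] from truncating. *)
Lemma distant_head_gt d k x s :
  distant d (x :: s) -> all (fun y => d * k < y) (x :: s) -> d * (k + size s) < x.
Proof.
elim: s x => [|y s IH] x /=; first by rewrite addn0 andbT.
case/andP=> xy ys /and3P[_ gt_y gt_s].
by have := IH y ys; rewrite /= gt_y gt_s => /(_ isT); nia.
Qed.

Lemma sub_stairK d k s :
  distant d s -> all (fun x => d * k < x) s ->
  add_stair d k (sub_stair d k s) = s.
Proof.
elim: s => //= x s IH xs gt_xs; have /andP[_ gt_s] := gt_xs.
have gt_x : d * (k + size s) < x by exact: distant_head_gt gt_xs.
by rewrite IH /distant ?(path_sorted xs) // size_sub_stair; congr (_ :: _); lia.
Qed.

Lemma all_odd_add_stair2 b k s :
  all (fun x => odd x == b) (add_stair 2 k s) = all (fun x => odd x == ~~ b) s.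
Proof. by elim: s => //= x s ->; congr (_ && _); case: b; lia. Qed.

(** * Non-increasing sequences and distinct parts *)

Lemma geq_trans : transitive geq. Proof. by move=> x y z /=; lia. Qed.
Lemma geq_total : total geq. Proof. by move=> x y /=; lia. Qed.
Lemma geq_anti : antisymmetric geq. Proof. by move=> x y /=; lia. Qed.

Lemma sorted_geq_eq s t : sorted geq s -> sorted geq t -> perm_eq s t -> s = t.
Proof. exact: (sorted_eq geq_trans geq_anti). Qed.

Lemma distant_geq d s : distant d s -> sorted geq s.
Proof. by apply: sub_sorted => x y /=; lia. Qed.

Lemma distant1_uniq s : distant 1 s = sorted geq s && uniq s.
Proof.
rewrite andbC -(rev_sorted leq) -rev_uniq -ltn_sorted_uniq_leq rev_sorted.
by apply: eq_sorted => x y; rewrite addn1.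
Qed.

Lemma distant_uniq d s : 0 < d -> distant d s -> uniq s.
Proof.
move=> d_gt0 ds; suff: distant 1 s by rewrite distant1_uniq => /andP[].
by apply: sub_sorted ds => x y /=; lia.
Qed.

(** Distinct numbers of equal parity differ by at least 2. *)
Lemma distant1_filter_parity (b : bool) s :
  distant 1 s -> distant 2 [seq x <- s | odd x == b].
Proof.
move=> ds; apply: (@sub_in_sorted _ (fun x => odd x == b) (fun x y => y + 1 <= x)).
- by move=> x y /eqP xb /eqP yb /=; lia.
- exact: filter_all.
- by apply: sorted_filter ds => x y z /=; lia.
Qed.

(** * Splitting by parity *)

Definition parity_split (b : bool) (s : seq nat) : seq nat :=
  [seq x <- s | odd x == b] ++ [seq x <- s | odd x == ~~ b].

Lemma perm_parity_split b s : perm_eq (parity_split b s) s.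
Proof.
apply: perm_trans (permEl (perm_filterC (fun x => odd x == b) s)).
rewrite /parity_split.
rewrite (@eq_filter _ (fun x => odd x == ~~ b) (predC (fun x => odd x == b))) // => x.
by rewrite /=; case: odd b => [] [].
Qed.

(** The parity filter picks from the sorted merge a non-increasing rearrangement of one block, hence
    that block itself. So sorting loses no information. *)
Lemma parity_split_sort b s t :
  sorted geq s -> sorted geq t -> all (fun x => odd x == b) s ->
  all (fun x => odd x == ~~ b) t -> parity_split b (sort geq (s ++ t)) = s ++ t.
Proof.
move=> ss st ps pt.
have filt c u : sorted geq u -> [seq x <- s ++ t | odd x == c] = u ->
    [seq x <- sort geq (s ++ t) | odd x == c] = u.
  move=> su uE; rewrite -uE in su *; apply: sorted_geq_eq => //.
  - by apply: sorted_filter (sort_sorted _ _); [exact: geq_trans | exact: geq_total].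
  - by apply: perm_filter; rewrite perm_sort.
have other c u : all (fun x => odd x == ~~ c) u -> [seq x <- u | odd x == c] = [::].
  move=> pu; apply/eqP; rewrite -(negbK (_ == _)) -has_filter -all_predC.
  by apply: sub_all pu => x /= /eqP ->; case: c.
rewrite /parity_split (filt b s) ?(filt (~~ b) t) //.
- by rewrite filter_cat (all_filterP pt) other // negbK.
- by rewrite filter_cat (all_filterP ps) other ?cats0.
Qed.

(** * The bijection for a fixed number of parts *)

Definition to_hat (v : seq nat) : seq nat :=
  sort geq (add_stair 2 0 (parity_split true v)).

(** The staircase 1, 3, 5, ... flips parities, so the block that was odd in [to_hat] is now the even
    one, and [false] restores the order. *)
Definition of_hat (u : seq nat) : seq nat :=
  sort geq (sub_stair 2 0 (parity_split false u)).

(** A bound on the minimum is a bound on every even part. In this form it is the lower bound that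
    [sub_stairK] requires at offset [count odd s]. *)
Lemma even_conditionE s :
  even_condition s = all (fun x => 2 * count odd s < x) [seq x <- s | odd x == false].
Proof.
rewrite (@eq_filter _ _ (fun x => ~~ odd x)) => [|x]; last by rewrite eqbF_neg.
rewrite /even_condition /smallest_even /odd_parts.
case: [seq x <- s | ~~ odd x] => //= x r; move: (2 * _) => c.
elim: r => [|y r IH] /=; first by rewrite andbT.
by rewrite leq_min IH andbCA.
Qed.

Lemma sorted_sort_geq s : sorted geq (sort geq s).
Proof. exact: (sort_sorted geq_total). Qed.

Lemma sort_parity_split b s : sorted geq s -> sort geq (parity_split b s) = s.
Proof.
move=> ss; apply: sorted_geq_eq => //; first exact: sorted_sort_geq.
by rewrite perm_sort perm_parity_split.
Qed.

Lemma parity_split_to_hat v : sorted geq v ->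
  parity_split false (to_hat v) = add_stair 2 0 (parity_split true v).
Proof.
move=> sv; have sf b : sorted geq [seq x <- v | odd x == b].
  exact: sorted_filter geq_trans _ _ sv.
rewrite /to_hat {2 3}/parity_split add_stair_cat parity_split_sort //.
- exact/distant_geq/distant_add_stair/sf.
- exact/distant_geq/distant_add_stair/sf.
- by rewrite all_odd_add_stair2 filter_all.
- by rewrite all_odd_add_stair2 filter_all.
Qed.

Lemma to_hatK v : sorted geq v -> of_hat (to_hat v) = v.
Proof.
by move=> sv; rewrite /of_hat parity_split_to_hat // add_stairK sort_parity_split.
Qed.

Lemma size_to_hat v : size (to_hat v) = size v.
Proof. by rewrite size_sort size_add_stair (perm_size (perm_parity_split _ _)). Qed.

Lemma size_of_hat u : size (of_hat u) = size u.
Proof. by rewrite size_sort size_sub_stair (perm_size (perm_parity_split _ _)). Qed.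

Lemma sumn_to_hat v : sumn (to_hat v) = sumn v + size v + 2 * 'C(size v, 2).
Proof.
rewrite (perm_sumn (permEl (perm_sort _ _))) sumn_add_stair.
by rewrite (perm_sumn (perm_parity_split _ _)) (perm_size (perm_parity_split _ _)).
Qed.

Lemma to_hat_gt0 v : all (fun x => 0 < x) (to_hat v).
Proof. by rewrite all_sort; exact: (add_stair_gt 2 0). Qed.

Lemma phat_prop_to_hat v : sorted geq v -> phat_prop (size v) (to_hat v).
Proof.
move=> sv; have sf b : sorted geq [seq x <- v | odd x == b].
  exact: sorted_filter geq_trans _ _ sv.
pose evens := [seq x <- v | odd x == false].
(* [A] becomes the even parts and [B] the odd ones. The offset of [A] is the size of [B], so
   [add_stair_gt] yields the even condition. *)
pose A := add_stair 2 (0 + size evens) [seq x <- v | odd x == true].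
pose B := add_stair 2 0 evens.
have oA : all (fun x => odd x == false) A by rewrite all_odd_add_stair2 filter_all.
have oB : all (fun x => odd x == true) B by rewrite all_odd_add_stair2 filter_all.
have perm_h : perm_eq (to_hat v) (A ++ B).
  by rewrite perm_sort /parity_split add_stair_cat.
have uA : uniq A by exact: (distant_uniq 2 _ isT (distant_add_stair _ _ _ (sf _))).
have uB : uniq B by exact: (distant_uniq 2 _ isT (distant_add_stair _ _ _ (sf _))).
apply/and3P; split; first by rewrite size_to_hat.
- rewrite distant1_uniq sorted_sort_geq (perm_uniq perm_h) cat_uniq uA uB andbT.
  apply/hasPn => x /(allP oB) /eqP xo; apply/negP => /(allP oA) /eqP.
  by rewrite xo.
- have cE : count odd (to_hat v) = size evens.
    rewrite (permP perm_h) count_cat.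
    have -> : count odd B = size B.
      by apply/eqP; rewrite -all_count; apply: sub_all oB => x /eqP ->.
    have -> : count odd A = 0.
      by apply/eqP; rewrite -leqn0 leqNgt -has_count -all_predC;
         apply: sub_all oA => x /eqP /= ->.
    by rewrite size_add_stair.
  rewrite even_conditionE cE (perm_all _ (perm_filter _ perm_h)) filter_cat.
  rewrite (all_filterP oA) all_cat add_stair_gt all_filter.
  by apply: sub_all oB => x /eqP /= ->.
Qed.

(** The subtraction is exact on both blocks: on the even parts by the even condition, on the odd
    parts by positivity. *)
Lemma of_hat_spec u : distant 1 u -> all (fun x => 0 < x) u -> even_condition u ->
  parity_split true (of_hat u) = sub_stair 2 0 (parity_split false u) /\
  add_stair 2 0 (sub_stair 2 0 (parity_split false u)) = parity_split false u.
Proof.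
move=> du u_gt0 eu.
set A := [seq x <- u | odd x == false]; set B := [seq x <- u | odd x == true].
have dA : distant 2 A by exact: distant1_filter_parity.
have dB : distant 2 B by exact: distant1_filter_parity.
have AK : add_stair 2 (size B) (sub_stair 2 (size B) A) = A.
  apply: sub_stairK => //; move: eu; rewrite even_conditionE /B size_filter.
  by rewrite (@eq_count _ _ odd) // => x; rewrite eqb_id.
have BK : add_stair 2 0 (sub_stair 2 0 B) = B.
  by apply: sub_stairK => //; rewrite all_filter; apply: sub_all u_gt0 => x /= ->; rewrite implybT.
rewrite /of_hat {2 3 4 5}/parity_split -/A -/B sub_stair_cat add_stair_cat.
rewrite size_sub_stair AK BK; split=> //; apply: parity_split_sort.
- exact: sorted_sub_stair.
- exact: sorted_sub_stair.
(* The parity of the differences is read off after adding the staircase back. *)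
- by rewrite -(all_odd_add_stair2 false (size B)) AK filter_all.
- by rewrite -(all_odd_add_stair2 true 0) BK filter_all.
Qed.

Lemma of_hatK u : distant 1 u -> all (fun x => 0 < x) u -> even_condition u ->
  to_hat (of_hat u) = u.
Proof.
move=> du u_gt0 eu; have [splitE addE] := of_hat_spec _ du u_gt0 eu.
by rewrite /to_hat splitE addE sort_parity_split // (distant_geq _ _ du).
Qed.

(** * Comparing numbers of partitions *)

Definition partition_list (n : nat) (P : pred (seq nat)) : seq (seq nat) :=
  [seq box_seq b | b <- enum [pred b : box n | is_partition n (box_seq b) && P (box_seq b)]].

Lemma mem_partition_list n P s :
  (s \in partition_list n P) = is_partition n s && P s.
Proof.
apply/mapP/idP => [[b] | /andP[part_s Ps]].
  by rewrite mem_enum => sb ->.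
have [b bE] := is_partition_box part_s.
by exists b => //; rewrite mem_enum inE bE part_s.
Qed.

Lemma partition_list_uniq n P : uniq (partition_list n P).
Proof. by rewrite map_inj_uniq ?enum_uniq //; exact: box_seq_inj. Qed.

Lemma size_partition_list n P : size (partition_list n P) = count_partitions n P.
Proof. by rewrite size_map -cardE. Qed.

(** The left inverse [g] makes [f] injective on the partitions counted on the left. Lists of plain
    sequences serve here because [box n] and [box m] are different types. *)
Lemma leq_count_partitions n m (P Q : pred (seq nat)) (f g : seq nat -> seq nat) :
  (forall s, is_partition n s -> P s ->
     [/\ is_partition m (f s), Q (f s) & g (f s) = s]) ->
  count_partitions n P <= count_partitions m Q.
Proof.
move=> fP; rewrite -!size_partition_list -(size_map f).
apply: uniq_leq_size => [|_ /mapP[s s_in ->]].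
  rewrite map_inj_in_uniq ?partition_list_uniq // => s t.
  rewrite !mem_partition_list => /andP[ps Ps] /andP[pt Pt] fE.
  by have [_ _ <-] := fP s ps Ps; have [_ _ <-] := fP t pt Pt; rewrite fE.
move: s_in; rewrite !mem_partition_list => /andP[ps Ps].
by have [-> -> _] := fP s ps Ps.
Qed.

Definition distant_of_size (d i : nat) (s : seq nat) : bool :=
  (size s == i) && distant d s.

Lemma count_distant_phat d i n m : n = m + (d - 2) * 'C(i, 2) -> 2 <= d ->
  count_partitions n (distant_of_size d i) = count_partitions m (phat_prop i).
Proof.
move=> nE hd; apply/eqP; rewrite eqn_leq; apply/andP; split.
- apply: (leq_count_partitions _ _ _ _ (to_hat \o sub_stair d 0)
                                       (add_stair d 0 \o of_hat)) => s /=.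
  case/and3P=> _ s_gt0 /eqP sumE /andP[/eqP szE ds].
  have sv := sorted_sub_stair _ 0 _ ds.
  have sK : add_stair d 0 (sub_stair d 0 s) = s by apply: sub_stairK; rewrite ?muln0.
  have := sumn_add_stair d (sub_stair d 0 s); rewrite sK size_sub_stair szE => sumE'.
  rewrite to_hatK // sK; split=> //.
    rewrite /is_partition sorted_sort_geq to_hat_gt0 sumn_to_hat size_sub_stair szE /=.
    (* With [v] the sequence left by [sub_stair], [n] is [sumn v + i + d * 'C(i, 2)] and the new sum
       has 2 in place of [d]. *)
    by apply/eqP; nia.
  by have := phat_prop_to_hat _ sv; rewrite size_sub_stair szE.
- apply: (leq_count_partitions _ _ _ _ (add_stair d 0 \o of_hat)
                                       (to_hat \o sub_stair d 0)) => u /=.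
  case/and3P=> _ u_gt0 /eqP sumE /and3P[/eqP szE du eu].
  have uK := of_hatK _ du u_gt0 eu.
  have := sumn_to_hat (of_hat u); rewrite uK size_of_hat szE => sumE'.
  have ds : distant d (add_stair d 0 (of_hat u)).
    exact/distant_add_stair/sorted_sort_geq.
  rewrite add_stairK uK; split=> //.
    rewrite /is_partition (distant_geq _ _ ds) sumn_add_stair size_of_hat szE /=.
    apply/andP; split; last by apply/eqP; nia.
    by apply: sub_all (add_stair_gt d 0 _) => x; rewrite muln0.
  by rewrite /distant_of_size size_add_stair size_of_hat szE eqxx.
Qed.

Lemma phat_distant d n i : 2 <= d -> 1 <= i ->
  phat i (n%:Z - (d%:Z - 2) * 'C(i, 2)%:Z)%R = count_partitions n (distant_of_size d i).
Proof.
move=> hd hi; rewrite /phat; case: ifPn => [m_gt0 | m_le0].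
  by apply/esym/count_distant_phat => //; nia.
(* Here [phat] is 0 by convention. A [d]-distant partition of [n] with [i >= 1] parts would make the
   argument at least [i + 2 * 'C(i, 2)], hence positive. *)
apply/esym/eqP; rewrite -leqn0 leqNgt -size_partition_list -has_predT; apply/hasPn => s.
rewrite mem_partition_list => /andP[/and3P[_ s_gt0 /eqP sumE] /andP[/eqP szE ds]].
have sK : add_stair d 0 (sub_stair d 0 s) = s by apply: sub_stairK; rewrite ?muln0.
have := sumn_add_stair d (sub_stair d 0 s); rewrite sK size_sub_stair szE sumE.
by move: m_le0; nia.
Qed.

(** * Summing over the number of parts *)

Lemma p_distant_sum d n : 1 <= n ->
  p_distant d n = \sum_(1 <= i < n.+1) count_partitions n (distant_of_size d i).
Proof.
move=> hn; rewrite /p_distant {1}/count_partitions -sum1_card.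
rewrite (partition_big (fun b : box n => inord (size b) : 'I_n.+1) predT) //=.
have szE (b : box n) : size (box_seq b) = (inord (size b) : 'I_n.+1).
  by rewrite size_map inordK // ltnS size_bseq.
transitivity (\sum_(0 <= i < n.+1) count_partitions n (distant_of_size d i)).
  rewrite big_mkord; apply: eq_bigr => i _; rewrite sum1_card.
  apply: eq_card => b; rewrite [LHS]unfold_in !inE /distant_of_size szE.
  by rewrite -andbA [distant _ _ && _]andbC.
(* The term [i = 0] vanishes: the empty sequence has sum 0, while [n >= 1]. *)
rewrite big_ltn //; apply/eqP; rewrite -[X in _ == X]add0n eqn_add2r -leqn0 leqNgt.
rewrite -size_partition_list -has_predT; apply/hasPn => s; rewrite mem_partition_list.
case/andP=> /and3P[_ _ /eqP sumE] /andP[/nilP sE _].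
by move: hn; rewrite -sumE sE.
Qed.

Lemma count_distant_leq_max_length d n i :
  count_partitions n (distant_of_size d i) <> 0 -> i <= max_length n d.
Proof.
move/eqP; rewrite -lt0n => /card_gt0P[b]; rewrite !inE => /andP[pb /andP[/eqP <- db]].
by apply: (@leq_bigmax_cond _ _ (fun b : box n => size (box_seq b))); rewrite pb.
Qed.

Theorem theorem3 (d n : nat) (hd : 2 <= d) (hn : 1 <= n) :
  p_distant d n
    = \big[addn/0]_(i \in [set i : nat | 1 <= i]%classic)
        phat i (n%:Z - (d%:Z - 2) * 'C(i, 2)%:Z)%R
  /\ (forall i : nat, 1 <= i ->
        phat i (n%:Z - (d%:Z - 2) * 'C(i, 2)%:Z)%R <> 0 ->
        i <= max_length n d).
Proof.
split; last by move=> i hi; rewrite phat_distant //; exact: count_distant_leq_max_length.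
(* The sum over all [i >= 1] reduces to the range from 1 to [n], since a partition of [n] has at
   most [n] parts. *)
rewrite p_distant_sum // -(@bigfs _ _ _ _ (index_iota 1 n.+1) (leq 1)) ?iota_uniq //.
  rewrite big_nat_cond [RHS]big_seq_cond; apply: eq_big => i.
    by rewrite andbT mem_index_iota /=; case: (0 < i); rewrite ?andbT.
  by rewrite andbT => /andP[hi _]; rewrite phat_distant.
move=> i hi; rewrite mem_index_iota hi /= ltnS -ltnNge => n_lt_i.
rewrite phat_distant //; apply: eq_card0 => b; rewrite !inE.
by rewrite /distant_of_size size_map ltn_eqF ?andbF // (leq_ltn_trans (size_bseq b)).
Qed.
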